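(* Let $x_0,\dots,x_m\in\mathbb{C}^n$ and $X=[x_0\ \cdots\ x_{m-1}]$. Let DMD eigenvalues $\lambda_1,\dots,\lambda_m$, DMD amplitudes $a_1,\dots,a_m$ and DMD modes $\vartheta_1,\dots,\vartheta_m$ be given by Companion Dynamic Mode Decomposition (CDMD) applied to $x_0,\dots,x_m$. If the DMD eigenvalues $\lambda_1,\dots,\lambda_m$ are distinct, then $$x_k=\sum_{j=1}^m\lambda_j^ka_j\vartheta_j\quad(k=0,\dots,m-1),\qquad x_m=\sum_{j=1}^m\lambda_j^ma_j\vartheta_j+q,$$ where $q=x_m-Xc$ with $c=X^+x_m$.
   Context: $M^+$ denotes the Moore-Penrose pseudoinverse of a matrix $M$. The convention $0^0=1$ is used. The companion matrix $C_c\in\mathbb{C}^{m\times m}$ to a vector $c=(c_0,\dots,c_{m-1})^T\in\mathbb{C}^m$ is the matrix whose $j$-th column, for $1\le j\le m-1$, is the standard basis vector $e_{j+1}$ and whose last column is $c$. $\operatorname{Vand}(\lambda_1,\dots,\lambda_m)\in\mathbb{C}^{m\times m}$ denotes the Vandermonde matrix with $(i,j)$ entry $\lambda_i^{j-1}$. CDMD applied to data $x_0,\dots,x_m\in\mathbb{C}^n$: with $X=[x_0\ \cdots\ x_{m-1}]$, compute $c=X^+x_m\in\mathbb{C}^m$ and form the companion matrix $C_c$. The DMD eigenvalues are the eigenvalues $\lambda_1,\dots,\lambda_m$ of $C_c$, with chosen eigenvectors $v_1,\dots,v_m$ ($C_cv_i=\lambda_iv_i$, $v_i\ne0$). The DMD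 modes are $\vartheta_i=Xv_i\in\mathbb{C}^n$. The DMD amplitudes $a_1,\dots,a_m$ are the diagonal entries of $K=\left(\operatorname{Vand}(\lambda_1,\dots,\lambda_m)\,[v_1\ \cdots\ v_m]\right)^+$ (a diagonal matrix $K=\operatorname{diag}(a_1,\dots,a_m)$ when the eigenvalues are distinct). *)

(* Defs.v *)
From HB Require Import structures.
From mathcomp Require Import all_boot all_order all_algebra.
From mathcomp Require Export reals complex.

Set Implicit Arguments.
Unset Strict Implicit.
Unset Printing Implicit Defensive.

Import Order.TTheory GRing.Theory Num.Theory.

Local Open Scope ring_scope.
Local Open Scope sesquilinear_scope.

(* The four Penrose equations; [A ^t*] is the conjugate transpose. *)
Definition penrose (C : numClosedFieldType) (m n : nat)
    (M : 'M[C]_(m, n)) (P : 'M[C]_(n, m)) : bool :=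
  [&& M *m P *m M == M, P *m M *m P == P,
      (M *m P) ^t* == M *m P & (P *m M) ^t* == P *m M].

Lemma ctmx_mul (C : numClosedFieldType) (m n p : nat)
    (A : 'M[C]_(m, n)) (B : 'M[C]_(n, p)) :
  (A *m B) ^t* = B ^t* *m A ^t*.
Proof. by rewrite trmx_mul map_mxM. Qed.

Lemma ctmxK (C : numClosedFieldType) (m n : nat) (A : 'M[C]_(m, n)) :
  A ^t* ^t* = A.
Proof. by apply/matrixP=> i j; rewrite !mxE conjCK. Qed.

Lemma gram_unit (C : numClosedFieldType) (m n : nat) (B : 'M[C]_(m, n)) :
  row_free B -> B *m B ^t* \in unitmx.
Proof.
move=> Bfree; rewrite -row_free_unit; apply: inj_row_free => v vBB0.
apply: (row_free_inj Bfree); rewrite mul0mx.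
have /matrixP/(_ 0 0) : (v *m B) *m (v *m B) ^t* = 0.
  by rewrite ctmx_mul mulmxA -(mulmxA v) vBB0 mul0mx.
rewrite !mxE => /eqP; rewrite psumr_eq0; last first.
  by move=> i _; rewrite [X in _ * X]mxE [X in _ * (X)^*]mxE mul_conjC_ge0.
move=> /allP vB0; apply/matrixP=> i j; rewrite (ord1 i) [RHS]mxE.
have := vB0 j (mem_index_enum j).
by rewrite [X in _ * X]mxE [X in _ * (X)^*]mxE mul_conjC_eq0 => /eqP.
Qed.

(* With a full rank factorization [M = A *m B], the pseudoinverse is
   [B^* (B B^* )^-1 (A^* A)^-1 A^*]. *)
Lemma penrose_ex (C : numClosedFieldType) (m n : nat) (M : 'M[C]_(m, n)) :
  exists P, penrose M P.
Proof.
have [r [A [B [defM Afree Bfree]]]] : exists r (A : 'M[C]_(m, r))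
    (B : 'M[C]_(r, n)), [/\ M = A *m B, row_free (A ^t*) & row_free B].
  exists (\rank M), (col_base M), (row_base M).
  split; [by rewrite mulmx_base | | exact: row_base_free].
  by rewrite /row_free mxrank_map mxrank_tr; apply: col_base_full.
have Au := gram_unit Afree; have Bu := gram_unit Bfree.
rewrite ctmxK in Au.
set G := A ^t* *m A in Au; set H := B *m B ^t* in Bu.
have Gh : (invmx G) ^t* = invmx G.
  by rewrite trmx_inv map_invmx ctmx_mul ctmxK.
have Hh : (invmx H) ^t* = invmx H.
  by rewrite trmx_inv map_invmx ctmx_mul ctmxK.
exists (B ^t* *m invmx H *m invmx G *m A ^t*).
have MP : M *m (B ^t* *m invmx H *m invmx G *m A ^t*)
          = A *m invmx G *m A ^t*.
  by rewrite defM !mulmxA -(mulmxA A) -/H mulmxK.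
have PM : (B ^t* *m invmx H *m invmx G *m A ^t*) *m M
          = B ^t* *m invmx H *m B.
  by rewrite defM !mulmxA -(mulmxA _ (A ^t*) A) -/G mulmxKV.
apply/and4P; split; apply/eqP.
- by rewrite MP defM !mulmxA -(mulmxA _ (A ^t*) A) -/G mulmxKV.
- by rewrite PM !mulmxA -(mulmxA _ B) -/H mulmxKV.
- by rewrite MP !ctmx_mul ctmxK Gh mulmxA.
- by rewrite PM !ctmx_mul ctmxK Hh mulmxA.
Qed.

Definition mp_pinv (C : numClosedFieldType) (m n : nat) (M : 'M[C]_(m, n)) :
  'M[C]_(n, m) := xchoose (penrose_ex M).

Lemma mp_pinvP (C : numClosedFieldType) (m n : nat) (M : 'M[C]_(m, n)) :
  penrose M (mp_pinv M).
Proof. exact: xchooseP. Qed.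

Lemma penrose_uniq (C : numClosedFieldType) (m n : nat) (M : 'M[C]_(m, n))
    (P Q : 'M[C]_(n, m)) :
  penrose M P -> penrose M Q -> P = Q.
Proof.
move=> /and4P[/eqP p1 /eqP p2 /eqP p3 /eqP p4].
move=> /and4P[/eqP q1 /eqP q2 /eqP q3 /eqP q4].
have MPQ : M *m P = M *m Q.
  by rewrite -[LHS]p3 -{1}q1 -(mulmxA (M *m Q)) ctmx_mul p3 q3 !mulmxA p1.
have PQM : P *m M = Q *m M.
  by rewrite -[LHS]p4 -{1}q1 -(mulmxA M) mulmxA ctmx_mul p4 q4 -!mulmxA
             (mulmxA M P) p1.
by rewrite -p2 PQM -mulmxA MPQ mulmxA q2.
Qed.

Definition cols_mx (C : numClosedFieldType) (n m : nat)
    (v : 'I_m -> 'cV[C]_n) : 'M[C]_(n, m) :=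
  \matrix_(i < n, j < m) v j i 0.

(* Column [j] is [e_(j+1)] for [j < m - 1] and the last column is [c];
   mathcomp's [companionmx] uses a transposed layout. *)
Definition companion (C : numClosedFieldType) (m : nat) (c : 'cV[C]_m) :
    'M[C]_m :=
  \matrix_(i < m, j < m)
    if j.+1 == m then c i 0 else (i == j.+1 :> nat)%:R.

(* mathcomp's [Vandermonde] has [(i, j)] entry [a 0 j ^+ i], hence the
   transpose; [0 ^+ 0 = 1]. *)
Definition Vand (C : numClosedFieldType) (m : nat) (lam : 'I_m -> C) :
    'M[C]_m :=
  (Vandermonde m (\row_j lam j))^T.

Definition dmd_X (C : numClosedFieldType) (n m : nat)
    (x : 'I_m.+1 -> 'cV[C]_n) : 'M[C]_(n, m) :=
  cols_mx (fun j : 'I_m => x (widen_ord (leqnSn m) j)).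

Definition dmd_c (C : numClosedFieldType) (n m : nat)
    (x : 'I_m.+1 -> 'cV[C]_n) : 'cV[C]_m :=
  mp_pinv (dmd_X x) *m x ord_max.

(* [lam], [a] and [theta] are DMD eigenvalues, amplitudes and modes produced
   by CDMD from [x], for some enumeration of the eigenvalues (with their
   algebraic multiplicities) and some choice [v] of eigenvectors. *)
Definition CDMD (C : numClosedFieldType) (n m : nat)
    (x : 'I_m.+1 -> 'cV[C]_n)
    (lam a : 'I_m -> C) (theta : 'I_m -> 'cV[C]_n) : Prop :=
  char_poly (companion (dmd_c x)) = \prod_(i < m) ('X - (lam i)%:P) /\
  exists v : 'I_m -> 'cV[C]_m,
    [/\ forall i, v i != 0 /\
          companion (dmd_c x) *m v i = lam i *: v i,
        forall i, theta i = dmd_X x *m v i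
      & forall i, a i = mp_pinv (Vand lam *m cols_mx v) i i].

(* Main.v *)
Require Import Defs.
From mathcomp Require Import all_boot all_order all_algebra.
Import GRing.Theory.
Local Open Scope ring_scope.

(** Write [C] for the companion matrix of [c], [V] for the Vandermonde matrix
    of the eigenvalues, [W] for the matrix whose columns are the eigenvectors
    [v_j], and [L] for the diagonal matrix of the eigenvalues.

    The Vandermonde rows are left eigenvectors of [C], so [V C = L V]
    ([Vand_companion]), while [C W = W L] by the choice of [W].  Hence [V W]
    commutes with [L], and distinctness of the eigenvalues makes it diagonal.
    Distinctness also makes [V] invertible; the diagonal entries of [V W] are
    then nonzero, because its [j]-th column is [V v_j] with [v_j <> 0].  So the
    pseudoinverse of [V W] is a genuine inverse, it equals the diagonal matrix
    of the amplitudes, and [W diag(a) V = 1] ([Vand_eigvec_resolution]).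

    The [k]-th column of this identity expands the basis vector [e_k] as the
    sum of the [lam_j ^ k a_j v_j] ([delta_eigvec_sum]); one more application
    of [C] to the last basis vector gives [c] as the same sum with [k = m]
    ([companion_vec_eigvec_sum]).  Multiplying by [X] turns [e_k] into [x_k]
    and [v_j] into the mode [theta_j]; the last snapshot differs from [X c]
    by the residual. *)

Lemma col_cols_mx (C : numClosedFieldType) (n m : nat)
    (v : 'I_m -> 'cV[C]_n) (i : 'I_m) :
  col i (cols_mx v) = v i.
Proof. by apply/colP => k; rewrite !mxE. Qed.

Section PseudoinverseAndVandermonde.

Context {C : numClosedFieldType} {m : nat}.
Implicit Types (lam : 'I_m -> C).

Lemma mp_pinv_unit (D E : 'M[C]_m) : D *m E = 1%:M -> mp_pinv D = E.
Proof.
move=> DE; have ED := mulmx1C DE.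
apply: penrose_uniq (mp_pinvP D) _.
by rewrite /penrose DE ED !mul1mx !eqxx trmx1 map_mx1 eqxx.
Qed.

Lemma VandE lam i j : Vand lam i j = lam i ^+ j.
Proof. by rewrite !mxE. Qed.

Lemma Vand_unit lam : injective lam -> Vand lam \in unitmx.
Proof.
move=> lam_inj; rewrite unitmx_tr unitmxE det_Vandermonde unitfE.
apply/prodf_neq0 => i _; apply/prodf_neq0 => j ltij.
by rewrite !mxE subr_eq0 (inj_eq lam_inj) neq_ltn ltij orbT.
Qed.

(** Comparing entries gives [(d_j - d_i) A_ij = 0]. *)
Lemma commute_diag_mx (d : 'rV[C]_m) (A : 'M[C]_m) :
    injective (d 0) -> A *m diag_mx d = diag_mx d *m A ->
  forall i j, i != j -> A i j = 0.
Proof.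
move=> d_inj /matrixP Ad i j neq_ij; have := Ad i j.
rewrite mul_mx_diag mul_diag_mx !mxE mulrC => /eqP.
rewrite -subr_eq0 -mulrBl mulf_eq0 subr_eq0 (inj_eq d_inj) eq_sym.
by rewrite (negPf neq_ij) => /eqP.
Qed.

End PseudoinverseAndVandermonde.

(** Every column of the companion matrix but the last is a shift, which turns
    the eigenvector equation into the recurrence [u_(j+1) = l * u_j]. *)
Lemma companion_left_eigenvector (C : numClosedFieldType) (m : nat)
    (c : 'cV[C]_m.+1) (u : 'rV[C]_m.+1) (l : C) :
  u *m companion c = l *: u -> forall j, u 0 j = l ^+ j * u 0 0.
Proof.
move=> /matrixP uC [j lt_jm]; elim: j lt_jm => [|j IHj] lt_jm.
  by rewrite mul1r; congr (u 0 _); apply: val_inj.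
have lt_j := ltnW lt_jm.
have := uC 0 (Ordinal lt_j); rewrite !mxE (bigD1 (Ordinal lt_jm)) //= big1.
  by rewrite !mxE /= (ltn_eqF lt_jm) eqxx mulr1 addr0 IHj exprS mulrA.
move=> i neq_i; rewrite !mxE /= (ltn_eqF lt_jm).
have /negPf-> : i != j.+1 :> nat by exact: neq_i.
by rewrite mulr0.
Qed.

(** A root of the characteristic polynomial has some left eigenvector, which
    by the previous lemma is a multiple of [(1, l, l ^ 2, ...)]; so the
    Vandermonde row is itself an eigenvector, without ever computing the
    characteristic polynomial. *)
Lemma Vand_companion (C : numClosedFieldType) (m : nat) (c : 'cV[C]_m)
    (lam : 'I_m -> C) :
    (forall i, root (char_poly (companion c)) (lam i)) ->
  Vand lam *m companion c = diag_mx (\row_i lam i) *m Vand lam.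
Proof.
case: m => [|m] in c lam *; first by rewrite [LHS]flatmx0 [RHS]flatmx0.
move=> lam_root; apply/row_matrixP => i.
rewrite !row_mul row_diag_mx -scalemxAl -rowE mxE.
have /eigenvalueP[u uC u_neq0] :
  eigenvalue (companion c) (lam i) by rewrite eigenvalue_root_char.
have uE := companion_left_eigenvector _ _ _ _ _ uC.
have uV : u = u 0 0 *: row i (Vand lam).
  by apply/rowP => j; rewrite uE !mxE mulrC.
have u0_neq0 : u 0 0 != 0.
  by apply: contraNneq u_neq0 => u0; rewrite uV u0 scale0r.
apply: (scalerI u0_neq0).
by rewrite scalemxAl -uV uC {1}uV !scalerA mulrC.
Qed.

Section EigenvectorExpansion.

Context {C : numClosedFieldType} {m : nat}.
Variables (c : 'cV[C]_m) (lam : 'I_m -> C) (v : 'I_m -> 'cV[C]_m).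
Hypothesis lam_root : forall i, root (char_poly (companion c)) (lam i).
Hypothesis v_eig : forall i, companion c *m v i = lam i *: v i.
Hypothesis v_neq0 : forall i, v i != 0.
Hypothesis lam_inj : injective lam.

Let D := Vand lam *m cols_mx v.
Let a i := mp_pinv D i i.

Lemma companion_cols_mx :
  companion c *m cols_mx v = cols_mx v *m diag_mx (\row_i lam i).
Proof.
apply/matrixP => k i; have /colP/(_ k) := v_eig i.
rewrite -[in LHS]col_cols_mx colE mulmxA -colE mxE => ->.
by rewrite mul_mx_diag !mxE mulrC.
Qed.

(** By associativity [(V W) L = V C W = L (V W)], with distinct entries on the
    diagonal of [L]. *)
Lemma Vand_eigvec_offdiag i j : i != j -> D i j = 0.
Proof.
apply: (@commute_diag_mx _ _ (\row_i lam i)).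
  by move=> k l; rewrite !mxE => /lam_inj.
by rewrite /D -mulmxA -companion_cols_mx mulmxA Vand_companion // mulmxA.
Qed.

(** The [i]-th column of [V W] is [V v_i], which vanishes outside its [i]-th
    entry; so [D i i = 0] would put the nonzero [v_i] in the kernel of the
    invertible [V]. *)
Lemma Vand_eigvec_diag_neq0 i : D i i != 0.
Proof.
apply: contraNneq (v_neq0 i) => Dii0.
have Vv0 : Vand lam *m v i = 0.
  rewrite -col_cols_mx colE mulmxA -colE; apply/colP => k.
  rewrite [LHS]mxE [RHS]mxE.
  by case: (eqVneq k i) => [-> | /Vand_eigvec_offdiag].
by rewrite -[v i](mulKmx (Vand_unit _ lam_inj)) Vv0 mulmx0.
Qed.

(** [D = V W] has the inverse [diag(a)], so [V (W diag(a)) = 1], and a right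
    inverse of a square matrix is also a left inverse. *)
Lemma Vand_eigvec_resolution :
  cols_mx v *m diag_mx (\row_i a i) *m Vand lam = 1%:M.
Proof.
pose E : 'M[C]_m := diag_mx (\row_i (D i i)^-1).
have DE : D *m E = 1%:M.
  apply/matrixP => i j; rewrite mul_mx_diag [LHS]mxE [X in _ * X]mxE [RHS]mxE.
  case: eqVneq => [-> | /Vand_eigvec_offdiag ->]; last by rewrite mul0r.
  exact: mulfV (Vand_eigvec_diag_neq0 j).
have -> : diag_mx (\row_i a i) = E.
  congr diag_mx; apply/rowP => i.
  by rewrite /a (mp_pinv_unit _ _ DE) !mxE eqxx.
by apply: mulmx1C; rewrite mulmxA.
Qed.

Lemma delta_eigvec_sum (k : 'I_m) :
  delta_mx k 0 = \sum_j (lam j ^+ k * a j) *: v j :> 'cV[C]_m.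
Proof.
have /matrixP E := Vand_eigvec_resolution.
apply/colP => i; have := E i k; rewrite !mxE eqxx andbT => <-.
rewrite summxE; apply: eq_bigr => j _.
rewrite mul_mx_diag VandE mxE [cols_mx v i j]mxE [X in _ * X * _]mxE [RHS]mxE.
by rewrite -mulrA [RHS]mulrC [a j * _]mulrC.
Qed.

(** [c] is the last column of the companion matrix, that is [C e_(m-1)], and
    [C] multiplies each term of the expansion of [e_(m-1)] by its eigenvalue. *)
Lemma companion_vec_eigvec_sum : c = \sum_j (lam j ^+ m * a j) *: v j.
Proof.
have [m0 | m_gt0] := posnP m.
  by apply/colP => i; have := ltn_ord i; rewrite {2}m0.
have lt_pm : (m.-1 < m)%N by rewrite prednK.
pose k := Ordinal lt_pm.
have -> : c = companion c *m delta_mx k 0.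
  by rewrite -colE; apply/colP => i; rewrite !mxE /= prednK // eqxx.
rewrite delta_eigvec_sum mulmx_sumr; apply: eq_bigr => j _.
by rewrite -scalemxAr v_eig scalerA /= mulrAC -exprSr prednK.
Qed.

End EigenvectorExpansion.

Theorem theorem4p8 (R : realType) (n m : nat)
    (x : 'I_m.+1 -> 'cV[R[i]]_n)
    (lam a : 'I_m -> R[i]) (theta : 'I_m -> 'cV[R[i]]_n) :
  CDMD x lam a theta ->
  injective lam ->
  (forall k : 'I_m.+1, (k < m)%N ->
     x k = \sum_(j < m) (lam j ^+ k * a j) *: theta j) /\
  x ord_max = \sum_(j < m) (lam j ^+ m * a j) *: theta j
              + (x ord_max - dmd_X x *m dmd_c x).
Proof.
move=> [char_lam [v [v_eigP thetaE aE]]] lam_inj.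
have lam_root i : root (char_poly (companion (dmd_c x))) (lam i).
  by rewrite char_lam (bigD1 i) //= rootM root_XsubC eqxx.
have v_eig i := (v_eigP i).2.
have v_neq0 i := (v_eigP i).1.
have modesE k : \sum_(j < m) (lam j ^+ k * a j) *: theta j =
    dmd_X x *m \sum_j (lam j ^+ k * mp_pinv (Vand lam *m cols_mx v) j j) *: v j.
  rewrite mulmx_sumr; apply: eq_bigr => j _.
  by rewrite thetaE aE scalemxAr.
split=> [k lt_km|]; rewrite modesE.
  have := delta_eigvec_sum _ _ _ lam_root v_eig v_neq0 lam_inj (Ordinal lt_km).
  move=> /= <-; rewrite -colE /dmd_X col_cols_mx.
  by congr (x _); apply: val_inj.
rewrite -(companion_vec_eigvec_sum _ _ _ lam_root v_eig v_neq0 lam_inj).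
by rewrite addrC subrK.
Qed.
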